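(* Let $k$ be a positive integer and let $\mathcal{A}^{(k)}$ be the set of all $k$-block Arndt compositions (of all weights $n\ge0$). Then $$\sum_{\sigma\in\mathcal{A}^{(k)}}x^{|\sigma|}y^{\mathrm{parts}(\sigma)}=\frac{1}{1-J_k(x,y)}\sum_{j=0}^{k-1}J_j(x,y),$$ where $J_0(x,y)=1$ and $J_j(x,y)=x^{\binom{j+1}{2}}y^j\prod_{\ell=1}^j\frac{1}{1-x^{\ell}}$ for $j\geq 1$.
   Context: A composition of $n\ge0$ is a finite sequence $\sigma=(\sigma_1,\dots,\sigma_\ell)$ of positive integers summing to $n=|\sigma|$, with $\mathrm{parts}(\sigma)=\ell$ (the empty composition is the composition of $0$ with $0$ parts). For a positive integer $k$, a $k$-block Arndt composition is a composition such that $\sigma_{ki-(k-1)}>\sigma_{ki-(k-2)}>\cdots>\sigma_{ki}$ for each positive integer $i$, where only the indices not exceeding $\ell$ are involved; equivalently, $\sigma_j>\sigma_{j+1}$ for every $j$ with $1\le j<\ell$ that is not a multiple of $k$ (so each consecutive block of $k$ parts, including a final incomplete block, is strictly decreasing). *)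

(* Defs.v *)
From HB Require Import structures.
From mathcomp Require Import all_boot all_order all_algebra.
From mathcomp Require Import boolp classical_sets cardinality fsbigop.

Set Implicit Arguments.
Unset Strict Implicit.
Unset Printing Implicit Defensive.

Import GRing.Theory.

Local Open Scope ring_scope.

(* Formal power series over R.  The bivariate ring Z[[x, y]] is represented
   below as Z[[y]][[x]] = fps (fps int), so that for F : fps (fps int) the
   coefficient of x^n y^m is F n m. *)
Record fps (R : Type) := Fps { fps_coef :> nat -> R }.

Lemma fpsP (R : Type) (f g : fps R) : (forall n, f n = g n) -> f = g.
Proof. by case: f g => f [g] /= fg; congr Fps; apply/funext. Qed.

HB.instance Definition _ (R : Type) := gen_eqMixin (fps R).
HB.instance Definition _ (R : Type) := gen_choiceMixin (fps R).

Section FpsZmodule.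
Variable R : zmodType.
Implicit Types f g h : fps R.

Definition fps_zero : fps R := Fps (fun=> 0).
Definition fps_opp f : fps R := Fps (fun n => - f n).
Definition fps_add f g : fps R := Fps (fun n => f n + g n).

Fact fps_addA : associative fps_add.
Proof. by move=> f g h; apply: fpsP => n /=; rewrite addrA. Qed.
Fact fps_addC : commutative fps_add.
Proof. by move=> f g; apply: fpsP => n /=; rewrite addrC. Qed.
Fact fps_add0 : left_id fps_zero fps_add.
Proof. by move=> f; apply: fpsP => n /=; rewrite add0r. Qed.
Fact fps_addN : left_inverse fps_zero fps_opp fps_add.
Proof. by move=> f; apply: fpsP => n /=; rewrite addNr. Qed.

HB.instance Definition _ :=
  GRing.isZmodule.Build (fps R) fps_addA fps_addC fps_add0 fps_addN.

Lemma coef_fps0 n : (0 : fps R) n = 0. Proof. by []. Qed.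
Lemma coef_fpsN f n : (- f) n = - f n. Proof. by []. Qed.
Lemma coef_fpsD f g n : (f + g) n = f n + g n. Proof. by []. Qed.
Lemma coef_fpsB f g n : (f - g) n = f n - g n. Proof. by []. Qed.

End FpsZmodule.

Section FpsRing.
Variable R : comNzRingType.
Implicit Types f g h : fps R.

Definition fps_const (c : R) : fps R := Fps (fun n => if n == 0%N then c else 0).
Definition fps_var : fps R := Fps (fun n => (n == 1%N)%:R).
Definition fps_mul f g : fps R := Fps (fun n => \sum_(i < n.+1) f i * g (n - i)%N).

Fact fps_mul_rev f g n : fps_mul f g n = \sum_(i < n.+1) f (n - i)%N * g i.
Proof.
rewrite /= (reindex_inj rev_ord_inj) /=; apply: eq_bigr => i _.
by rewrite subSS subKn // -ltnS.
Qed.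

Fact fps_mulC : commutative fps_mul.
Proof.
move=> f g; apply: fpsP => n; rewrite fps_mul_rev /=.
by apply: eq_bigr => i _; rewrite mulrC.
Qed.

Fact fps_mulA : associative fps_mul.
Proof.
move=> p q r; apply: fpsP => i; rewrite [RHS]fps_mul_rev.
transitivity (\sum_(j < i.+1) p j * (fps_mul q r) (i - j)%N) => //.
pose coef3 j k := p j * (q (i - j - k)%N * r k).
transitivity (\sum_(j < i.+1) \sum_(k < i.+1 | (k <= i - j)%N) coef3 j k).
  apply: eq_bigr => j _; rewrite fps_mul_rev big_distrr /=.
  by rewrite (big_ord_narrow_leq (leq_subr _ _)).
rewrite (exchange_big_dep predT) //=; apply: eq_bigr => k _.
transitivity (\sum_(j < i.+1 | (j <= i - k)%N) coef3 j k).
  apply: eq_bigl => j; rewrite -ltnS -(ltnS j) -!subSn ?leq_ord //.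
  by rewrite -subn_gt0 -(subn_gt0 j) -!subnDA addnC.
rewrite (big_ord_narrow_leq (leq_subr _ _)) big_distrl /=.
by apply: eq_bigr => j _; rewrite /coef3 -!subnDA addnC mulrA.
Qed.

Fact fps_mul1 : left_id (fps_const 1) fps_mul.
Proof.
move=> f; apply: fpsP => n /=.
by rewrite big_ord_recl /= subn0 mul1r big1 ?addr0 // => i _; rewrite mul0r.
Qed.

Fact fps_mulDl : left_distributive fps_mul +%R.
Proof.
move=> f g h; apply: fpsP => n /=; rewrite -big_split /=.
by apply: eq_bigr => i _; rewrite mulrDl.
Qed.

Fact fps_const1_neq0 : fps_const 1 != 0.
Proof.
apply/eqP => /(congr1 (fun f : fps R => f 0%N)) /= /eqP.
by rewrite oner_eq0.
Qed.

HB.instance Definition _ := GRing.Zmodule_isComNzRing.Build (fps R)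
  fps_mulA fps_mulC fps_mul1 fps_mulDl fps_const1_neq0.

Lemma coef_fps1 n : (1 : fps R) n = (n == 0%N)%:R.
Proof. by case: n. Qed.

Lemma coef_fpsM f g n : (f * g) n = \sum_(i < n.+1) f i * g (n - i)%N.
Proof. by []. Qed.

Lemma coef0_fpsM f g : (f * g) 0%N = f 0%N * g 0%N.
Proof. by rewrite coef_fpsM big_ord1. Qed.

End FpsRing.

Arguments fps_var {R}.

Section FpsUnit.
Variable R : comUnitRingType.
Implicit Types f g : fps R.

Definition fps_unit : {pred fps R} := fun f => f 0%N \is a GRing.unit.

(* The coefficients g_0, ..., g_n of the inverse of f, determined by
   f_0 g_0 = 1 and \sum_(i <= n) f_i g_(n - i) = 0 for n > 0. *)
Fixpoint fps_inv_seq f n : seq R :=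
  if n is m.+1 then
    let s := fps_inv_seq f m in
    rcons s (- (f 0%N)^-1 * \sum_(i < m.+1) f i.+1 * s`_(m - i))
  else [:: (f 0%N)^-1].

Definition fps_inv f : fps R :=
  if f \in fps_unit then Fps (fun n => (fps_inv_seq f n)`_n) else f.

Fact size_fps_inv_seq f n : size (fps_inv_seq f n) = n.+1.
Proof. by elim: n => //= n IHn; rewrite size_rcons IHn. Qed.

Fact nth_fps_inv_seq f n i :
  (i <= n)%N -> (fps_inv_seq f n)`_i = (fps_inv_seq f i)`_i.
Proof.
elim: n => [|n IHn]; first by rewrite leqn0 => /eqP->.
rewrite leq_eqVlt => /orP[/eqP-> //|lt_in].
by rewrite /= nth_rcons size_fps_inv_seq lt_in IHn.
Qed.

Fact fps_mulV : {in fps_unit, left_inverse 1 fps_inv *%R}.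
Proof.
move=> f Uf; rewrite mulrC /fps_inv Uf; apply: fpsP => n.
rewrite coef_fpsM coef_fps1; case: n => [|n].
  by rewrite big_ord1 /= divrr.
rewrite big_ord_recl subn0 /= nth_rcons size_fps_inv_seq ltnn eqxx.
rewrite mulrA mulrN divrr // mulN1r addrC; apply/eqP; rewrite subr_eq0.
apply/eqP; apply: eq_bigr => i _; congr (_ * _).
by rewrite [RHS]nth_fps_inv_seq ?leq_subr // /bump /= add1n subSS.
Qed.

Fact fps_unitPl f g : g * f = 1 -> fps_unit f.
Proof.
move=> /(congr1 (fun h : fps R => h 0%N)); rewrite coef0_fpsM => gf1.
by apply/unitrP; exists (g 0%N); rewrite [_ * g _]mulrC gf1.
Qed.

Fact fps_inv_out : {in [predC fps_unit], fps_inv =1 id}.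
Proof. by move=> f; rewrite inE /= /fps_inv => /negbTE->. Qed.

HB.instance Definition _ := GRing.ComNzRing_hasMulInverse.Build (fps R)
  fps_mulV fps_unitPl fps_inv_out.

Lemma fps_unitE f : (f \is a GRing.unit) = (f 0%N \is a GRing.unit).
Proof. by []. Qed.

End FpsUnit.

(* Unconditional formal summation of a family in R[[x, y]]: every monomial
   occurs in finitely many terms, and coefficients add up. *)
Definition fps2_has_sum (R : zmodType) (T : choiceType) (A : set T)
    (F : T -> fps (fps R)) (S : fps (fps R)) : Prop :=
  forall n m,
    finite_set [set t | A t /\ F t n m <> 0]%classic /\
    \sum_(t \in A) F t n m = S n m.

Definition is_composition (s : seq nat) : bool := all (fun p => 0 < p)%N s.

(* The j-th part, 1-indexed. *)
Definition part (s : seq nat) (j : nat) : nat := nth 0%N s j.-1.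

Definition block_arndt (k : nat) : set (seq nat) :=
  fun s => is_composition s /\
    forall i j : nat, (0 < i)%N ->
      (k * i - (k - 1) <= j)%N -> (j < k * i)%N -> (j < size s)%N ->
      (part s j > part s j.+1)%N.

Definition xvar : fps (fps int) := fps_var.
Definition yvar : fps (fps int) := fps_const fps_var.

Definition J (j : nat) : fps (fps int) :=
  if j is 0 then 1
  else xvar ^+ 'C(j.+1, 2) * yvar ^+ j *
       \prod_(1 <= l < j.+1) (1 - xvar ^+ l)^-1.

Lemma coef0_xvarX l : (0 < l)%N -> (xvar ^+ l) 0%N = 0.
Proof. by case: l => // l _; rewrite exprS coef0_fpsM mul0r. Qed.

Lemma unit_1BxvarX l : (0 < l)%N -> 1 - xvar ^+ l \is a GRing.unit.
Proof. by move=> l0; rewrite fps_unitE coef_fpsB coef0_xvarX // subr0 unitr1. Qed.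

Lemma unit_1BJ k : (0 < k)%N -> 1 - J k \is a GRing.unit.
Proof.
case: k => // k _; rewrite fps_unitE coef_fpsB /J !coef0_fpsM coef0_xvarX.
  by rewrite !mul0r subr0 unitr1.
by rewrite bin_gt0.
Qed.

(* Main.v *)
Require Import Defs.
From mathcomp Require Import all_boot all_order all_algebra.
From mathcomp Require Import boolp classical_sets functions cardinality fsbigop.
From mathcomp Require Import zify.

(** Cutting off its first [k] parts decomposes a [k]-block Arndt composition
    uniquely as a strictly decreasing block of [k] parts followed by a [k]-block
    Arndt composition, unless it has fewer than [k] parts, in which case it is
    just strictly decreasing.  Hence the generating function [S] satisfies
    [S = \sum_(j < k) D j + D k * S], where [D j] counts the strictly decreasing
    compositions with [j] parts.  Lowering all parts by one leaves [j] positive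
    parts, or [j - 1] positive parts followed by a zero, so that
    [D j = x ^ j * (D j + y * D (j - 1))]; this recurrence gives [D j = J j]. *)

Set Implicit Arguments.
Unset Strict Implicit.
Unset Printing Implicit Defensive.

Import GRing.Theory.

Local Open Scope classical_set_scope.
Local Open Scope ring_scope.

(** * Coefficients of bivariate power series *)

Lemma coef_fps_sum (R : zmodType) (I : Type) (r : seq I) (F : I -> fps R) n :
  (\sum_(i <- r) F i) n = \sum_(i <- r) F i n.
Proof. by elim/big_rec2: _ => // i f g _ <-. Qed.

Lemma coef_fps2M (R : comNzRingType) (F G : fps (fps R)) n m :
  (F * G) n m =
  \sum_(i < n.+1) \sum_(j < m.+1) F i j * G (n - i)%N (m - j)%N.
Proof. by rewrite coef_fpsM coef_fps_sum. Qed.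

Lemma coef_fps_varX (R : comNzRingType) a n :
  (fps_var ^+ a : fps R) n = (n == a)%:R.
Proof.
elim: a n => [|a IHa] n; first by rewrite expr0 coef_fps1.
rewrite exprS coef_fpsM; case: n => [|n]; first by rewrite big_ord1 mul0r.
rewrite big_ord_recl mul0r add0r big_ord_recl mul1r /= big1 ?addr0.
  by rewrite /bump /= subSS subn0 IHa.
by move=> i _; rewrite mul0r.
Qed.

Lemma fps_constX (R : comNzRingType) (c : R) b :
  fps_const c ^+ b = fps_const (c ^+ b).
Proof.
elim: b => // b IHb; rewrite !exprS IHb; apply: fpsP => n.
rewrite coef_fpsM big_ord_recl big1 ?addr0 /=; last by move=> i _; rewrite mul0r.
by rewrite subn0; case: eqP => // _; rewrite mulr0.
Qed.

Lemma coef_fpsM_const (R : comNzRingType) (f : fps R) (c : R) n :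
  (f * fps_const c) n = f n * c.
Proof.
rewrite coef_fpsM big_ord_recr /= subnn big1 ?add0r // => i _.
by rewrite subn_eq0 leqNgt ltn_ord mulr0.
Qed.

Lemma coef_monomial a b n m :
  (xvar ^+ a * yvar ^+ b) n m = ((n == a) && (m == b))%:R.
Proof.
rewrite /xvar /yvar fps_constX coef_fpsM_const coef_fps_varX -mulnb natrM.
by case: eqP => _; rewrite ?mul1r ?coef_fps_varX ?mul0r.
Qed.

(** * Formal summation *)

Section HasSum.
Variable T : choiceType.

(** One finite list can serve all coefficients of degree at most [n] in [x] and [m] in [y], since
    these are finitely many and each has finite support. This form suits products, whose
    coefficients involve all lower ones, and replaces sums over sets by sums over lists. *)
Lemma fps2_has_sumP (R : zmodType) (A : set T) (F : T -> fps (fps R)) S :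
  fps2_has_sum A F S <->
  forall n m, exists r : seq T, [/\ uniq r, [set` r] `<=` A &
    forall i j, (i <= n)%N -> (j <= m)%N ->
      (forall t, A t -> t \notin r -> F t i j = 0) /\
      (\sum_(t <- r) F t) i j = S i j].
Proof.
split=> [AFS n m|AFS n m].
  (* The union of the supports of all coefficients in the rectangle of indices bounded by
     [(n, m)]. *)
  pose B := \bigcup_(p in `I_n.+1 `*` `I_m.+1)
    [set t | A t /\ F t p.1 p.2 <> 0].
  have finB : finite_set B.
    apply: bigcup_finite => [|[i j] _]; first by apply: finite_setX; apply: finite_II.
    by have [] := AFS i j.
  have [r B_r r_uniq] : exists2 r : seq T, B = [set` r] & uniq r.
    have /finite_seqP[r B_r] := finB; exists (undup r); last exact: undup_uniq.
    by rewrite B_r; apply/seteqP; split=> t /=; rewrite mem_undup.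
  have rA : [set` r] `<=` A by rewrite -B_r => t [p _ []].
  exists r; split=> // i j lein lejm.
  have F0 t : A t -> t \notin r -> F t i j = 0.
    move=> At tr; apply: contrapT => Ft; move/negP: tr; apply.
    suff: B t by rewrite B_r.
    by exists (i, j); rewrite //= !ltnS.
  split=> //; have [_ <-] := AFS i j.
  rewrite (fsbigE r) // !coef_fps_sum big_seq [RHS]big_seq_cond.
  by apply: eq_bigl => t; case: (boolP (t \in r)) => // /rA At; rewrite mem_set.
have [r [r_uniq rA /(_ n m (leqnn _) (leqnn _))[F0 Fsum]]] := AFS n m; split.
  apply: (@sub_finite_set _ _ [set` r]); last exact: finite_seq.
  by move=> t [At Ft] /=; apply/negPn/negP => /(F0 t At).
rewrite -Fsum (fsbigE r) // !coef_fps_sum big_seq_cond [RHS]big_seq.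
by apply: eq_bigl => t; case: (boolP (t \in r)) => // /rA At; rewrite mem_set.
Qed.

Lemma fps2_has_sum_unique (R : zmodType) (A : set T) (F : T -> fps (fps R)) S S' :
  fps2_has_sum A F S -> fps2_has_sum A F S' -> S = S'.
Proof.
by move=> H H'; apply: fpsP => n; apply: fpsP => m; have [_ <-] := H n m;
  have [_ <-] := H' n m.
Qed.

Lemma eq_fps2_has_sum (R : zmodType) (A : set T) (F G : T -> fps (fps R)) S :
  (forall t, A t -> F t = G t) -> fps2_has_sum A F S -> fps2_has_sum A G S.
Proof.
move=> FG /fps2_has_sumP AFS; apply/fps2_has_sumP => n m.
have [r [r_uniq rA AFSr]] := AFS n m; exists r; split=> // i j lein lejm.
have [F0 <-] := AFSr i j lein lejm; split.
  by move=> t At tr; rewrite -FG // F0.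
by congr (fps_coef (fps_coef _ _) _); apply: eq_big_seq => t /rA /FG.
Qed.

Lemma fps2_has_sum_set1 (R : zmodType) (t : T) (F : T -> fps (fps R)) :
  fps2_has_sum [set t] F (F t).
Proof.
apply/fps2_has_sumP => n m; exists [:: t]; split=> //.
  by move=> u; rewrite /= inE => /eqP.
move=> i j _ _; rewrite big_seq1; split=> // u ->.
by rewrite inE eqxx.
Qed.

Lemma fps2_has_sumU (R : zmodType) (A B : set T) (F : T -> fps (fps R)) S S' :
  A `&` B `<=` set0 -> fps2_has_sum A F S -> fps2_has_sum B F S' ->
  fps2_has_sum (A `|` B) F (S + S').
Proof.
move=> AB0 /fps2_has_sumP AFS /fps2_has_sumP BFS; apply/fps2_has_sumP => n m.
have [r [r_uniq rA AFSr]] := AFS n m; have [q [q_uniq qB BFSq]] := BFS n m.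
exists (r ++ q); split.
- rewrite cat_uniq r_uniq q_uniq andbT; apply/hasPn => t tq.
  by apply/negP => tr; apply: (AB0 t); split; [apply: rA|apply: qB].
- by move=> t /=; rewrite mem_cat => /orP[/rA|/qB]; [left|right].
move=> i j lein lejm; have [FA FSA] := AFSr i j lein lejm.
have [FB FSB] := BFSq i j lein lejm; split.
  by move=> t [At|Bt]; rewrite mem_cat negb_or => /andP[tr tq]; [apply: FA|apply: FB].
by rewrite big_cat /= FSA FSB.
Qed.

End HasSum.

Lemma fps2_has_sum_image (R : zmodType) (T U : choiceType) (h : T -> U)
    (A : set T) (F : U -> fps (fps R)) S :
  set_inj A h -> fps2_has_sum A (F \o h) S -> fps2_has_sum (h @` A) F S.
Proof.
move=> h_inj /fps2_has_sumP AFS; apply/fps2_has_sumP => n m.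
have [r [r_uniq rA AFSr]] := AFS n m; exists (map h r); split.
- rewrite map_inj_in_uniq // => t u /rA At /rA Au.
  by apply: h_inj; rewrite inE.
- by move=> _ /mapP[t /rA At ->]; exists t.
move=> i j lein lejm; have [F0 FS] := AFSr i j lein lejm; split.
  move=> _ [t At <-] tr; apply: F0 => //.
  by apply: contra tr => /(map_f h).
by rewrite big_map.
Qed.

Lemma fps2_has_sumM (R : comNzRingType) (T U : choiceType) (A : set T)
    (B : set U) (F : T -> fps (fps R)) (G : U -> fps (fps R)) S S' :
  fps2_has_sum A F S -> fps2_has_sum B G S' ->
  fps2_has_sum (A `*` B) (fun p => F p.1 * G p.2) (S * S').
Proof.
move=> /fps2_has_sumP AFS /fps2_has_sumP BGS; apply/fps2_has_sumP => n m.
have [r [r_uniq rA AFSr]] := AFS n m; have [q [q_uniq qB BGSq]] := BGS n m.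
(* Outside this grid one factor has all its coefficients up to [(n, m)] equal to zero, hence so has
   the product. *)
exists [seq (t, u) | t <- r, u <- q]; split.
- by apply: allpairs_uniq => // -[? ?] [? ?].
- by move=> _ /allpairsP[[t u] /= [/rA At /qB Bu ->]].
move=> i j lein lejm; split=> [[t u] [/= At Bu] tu|].
  rewrite coef_fps2M big1 // => a _; rewrite big1 // => b _.
  have lea : (a <= n)%N by have := ltn_ord a; lia.
  have leb : (b <= m)%N by have := ltn_ord b; lia.
  have lea' : (i - a <= n)%N by lia.
  have leb' : (j - b <= m)%N by lia.
  have [tr|tr] := boolP (t \in r); last first.
    by have [-> //] := AFSr a b lea leb; rewrite mul0r.
  have [uq|uq] := boolP (u \in q); last first.
    by have [-> //] := BGSq _ _ lea' leb'; rewrite mulr0.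
  by move: tu; rewrite allpairs_f.
rewrite big_allpairs /=; under eq_bigr do rewrite -mulr_sumr.
rewrite -mulr_suml !coef_fps2M; apply: eq_bigr => a _; apply: eq_bigr => b _.
have lea : (a <= n)%N by have := ltn_ord a; lia.
have leb : (b <= m)%N by have := ltn_ord b; lia.
have lea' : (i - a <= n)%N by lia.
have leb' : (j - b <= m)%N by lia.
by have [_ ->] := AFSr a b lea leb; have [_ ->] := BGSq _ _ lea' leb'.
Qed.

(** A scalar multiple is a product with a family indexed by one point. *)
Lemma fps2_has_sumZ (R : comNzRingType) (T : choiceType) (A : set T)
    (c : fps (fps R)) (F : T -> fps (fps R)) S :
  fps2_has_sum A F S -> fps2_has_sum A (fun t => c * F t) (c * S).
Proof.
move=> AFS; have H := fps2_has_sumM (fps2_has_sum_set1 tt (fun=> c)) AFS.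
have -> : A = snd @` ([set tt] `*` A).
  by apply/seteqP; split=> [t At|_ [[[] t] [/= _ At] <-] //]; exists (tt, t).
apply: fps2_has_sum_image; first by move=> [[] t] [[] u] _ _ /= ->.
by apply: eq_fps2_has_sum H.
Qed.

(** * Compositions *)

Definition weight (s : seq nat) : fps (fps int) :=
  xvar ^+ sumn s * yvar ^+ size s.

Lemma weight_cat s t : weight (s ++ t) = weight s * weight t.
Proof. by rewrite /weight sumn_cat size_cat !exprD mulrACA. Qed.

Lemma sumn_map_succn s : sumn (map succn s) = (sumn s + size s)%N.
Proof. by elim: s => //= a s ->; lia. Qed.

Lemma leq_mem_sumn (s : seq nat) a : a \in s -> (a <= sumn s)%N.
Proof. by elim: s => //= b s IHs; rewrite inE => /orP[/eqP->|/IHs]; lia. Qed.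

Lemma finite_bounded_seq n m :
  finite_set [set s : seq nat | size s = m /\ (forall a, a \in s -> (a <= n)%N)].
Proof.
apply: (@sub_finite_set _ _
  ((fun t : m.-tuple 'I_n.+1 => map val t) @` [set: m.-tuple 'I_n.+1])).
  move=> s [sz_s s_le]; exists (map_tuple inord (Tuple (introT eqP sz_s))) => //=.
  rewrite -map_comp map_id_in // => a /s_le le_an /=.
  by rewrite inordK.
exact/finite_image/finite_finset.
Qed.

(** A sequence contributes only to the coefficient at its sum and length, and only finitely many
    sequences share both, even with zero entries allowed. With existence settled, a series can be
    identified by solving an equation for it. *)
Lemma fps2_has_sum_weight (A : set (seq nat)) :
  exists S, fps2_has_sum A weight S.
Proof.
exists (Fps (fun n => Fps (fun m => \sum_(s \in A) weight s n m))) => n m.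
split=> //; apply: sub_finite_set (finite_bounded_seq n m) => s [_].
rewrite /weight coef_monomial; case: eqP => // ->; case: eqP => // -> _.
by split=> // a; apply: leq_mem_sumn.
Qed.

(** * Strictly decreasing compositions *)

(** With [pairwise], a new last entry is compared at once with all the earlier ones. *)
Definition decreasing (j : nat) : set (seq nat) :=
  [set s | [/\ is_composition s, size s = j & pairwise gtn s]].

Lemma decreasingS j :
  decreasing j.+1 =
  map succn @` (decreasing j.+1 `|` rcons^~ 0%N @` decreasing j).
Proof.
have pairwiseS s : pairwise gtn (map succn s) = pairwise gtn s.
  by rewrite pairwise_map; apply: eq_pairwise => a b.
apply/seteqP; split=> [s [s_pos sz_s s_dec]|_ [s + <-]].
  have s_eq : s = map succn (map predn s).
    rewrite -map_comp map_id_in // => a /(allP s_pos) /= a_pos.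
    by rewrite prednK.
  exists (map predn s); last by rewrite -s_eq.
  move: sz_s s_dec; rewrite s_eq size_map pairwiseS.
  rewrite -map_comp (@eq_map _ _ (predn \o succn) id) // map_id.
  move: (map predn s) => {s s_pos s_eq}; case/lastP => // s a.
  rewrite pairwise_rcons size_rcons => -[sz_s] /andP[s_gt s_dec].
  (* All earlier entries exceed the last one, so they stay positive after the lowering; only the
     last can become zero. *)
  case: a s_gt => [|a] s_gt; [right; exists s => //|left].
  split; rewrite ?size_rcons ?sz_s ?pairwise_rcons ?s_gt //.
  rewrite /is_composition all_rcons /=; apply: sub_all s_gt => b /=.
  exact: leq_trans.
move=> [[_ sz_s s_dec]|[t [t_pos sz_t t_dec] <-]].
  split; rewrite ?size_map ?pairwiseS //.
  by rewrite /is_composition all_map; apply/allP.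
split; rewrite ?size_map ?size_rcons ?sz_t ?pairwiseS ?pairwise_rcons ?t_dec ?andbT //.
by rewrite /is_composition all_map; apply/allP.
Qed.

Lemma JS j : J j.+1 * (1 - xvar ^+ j.+1) = xvar ^+ j.+1 * (yvar * J j).
Proof.
(* The closed formula also covers [J 0]: the binomial coefficient vanishes and the product is
   empty. *)
have -> : J j = xvar ^+ 'C(j.+1, 2) * yvar ^+ j *
       \prod_(1 <= l < j.+1) (1 - xvar ^+ l)^-1.
  by case: j => // ; rewrite /J big_geq // !mulr1.
rewrite /J big_nat_recr //= -!mulrA mulVr ?unit_1BxvarX // mulr1.
by rewrite binS bin1 exprD [yvar ^+ _]exprS -!mulrA mulrCA [X in _ * X]mulrCA.
Qed.

Lemma fps2_has_sum_decreasing j : fps2_has_sum (decreasing j) weight (J j).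
Proof.
elim: j => [|j IHj].
  have -> : decreasing 0 = [set [::]].
    by apply/seteqP; split=> [s [_ /size0nil]|_ ->].
  have -> : J 0 = weight [::] by rewrite /weight !expr0 mulr1.
  exact: fps2_has_sum_set1.
have [S HS] := fps2_has_sum_weight (decreasing j.+1).
(* By [JS], [J j.+1] solves this linear equation too; cancelling the unit [1 - xvar ^+ j.+1] gives
   equality. *)
suff : S = xvar ^+ j.+1 * (S + yvar * J j).
  rewrite mulrDr -JS addrC => /eqP; rewrite -subr_eq -{1}[S]mul1r -mulrBl mulrC.
  by move=> /eqP/(mulIr (unit_1BxvarX (ltn0Sn j))) <-.
apply: (fps2_has_sum_unique HS); rewrite decreasingS.
apply: fps2_has_sum_image; first by move=> s t _ _; apply/inj_map/succn_inj.
have size_low s :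
    (decreasing j.+1 `|` rcons^~ 0%N @` decreasing j) s -> size s = j.+1.
  by move=> [[]|[t [_ sz_t _] <-]] //; rewrite size_rcons sz_t.
(* Raising each of the [j.+1] entries by one adds [j.+1] to the sum and keeps the length. *)
apply: (@eq_fps2_has_sum _ _ _ (fun s => xvar ^+ j.+1 * weight s)).
  move=> s /size_low sz_s; rewrite /weight /= sumn_map_succn size_map sz_s.
  by rewrite mulrA -exprD addnC.
apply: fps2_has_sumZ; apply: fps2_has_sumU => //.
  move=> s [[s_pos _ _] [t _ t_eq]]; move: s_pos.
  by rewrite -t_eq /is_composition all_rcons.
apply: fps2_has_sum_image; first by move=> s t _ _ /rcons_inj[].
(* An appended zero changes only the length, whence the factor [yvar]. *)
apply: (@eq_fps2_has_sum _ _ _ (fun s => yvar * weight s)).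
  move=> s _; rewrite /= -cats1 weight_cat mulrC /weight /=.
  by rewrite expr0 mul1r expr1.
exact: fps2_has_sumZ.
Qed.

Lemma fps2_has_sum_decreasing_lt k :
  fps2_has_sum [set s | decreasing (size s) s /\ (size s < k)%N] weight
    (\sum_(0 <= j < k) J j).
Proof.
elim: k => [|k IHk].
  rewrite big_geq //; apply/fps2_has_sumP => n m; exists [::].
  by split=> // i j _ _; rewrite big_nil; split=> // s [].
rewrite big_nat_recr //=.
have -> : [set s | decreasing (size s) s /\ (size s < k.+1)%N] =
    [set s | decreasing (size s) s /\ (size s < k)%N] `|` decreasing k.
  apply/seteqP; split=> s /=.
    rewrite ltnS leq_eqVlt => -[s_dec /orP[/eqP <-|lt_sk]]; first by right.
    by left.
  by move=> [[s_dec /ltnW]|] // [s_pos <- s_dec].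
apply: fps2_has_sumU => //; last exact: fps2_has_sum_decreasing.
by move=> s [[_ +] [_ sz_s _]]; rewrite sz_s ltnn.
Qed.

(** * Block Arndt compositions *)

(** Passes from blocks to single indices: the 0-based position [j] is the 1-based index [j.+1], and
    a comparison is skipped exactly when that index ends a block. *)
Lemma block_arndtE k s : (0 < k)%N ->
  block_arndt k s <-> is_composition s /\
    forall j, (j.+1 < size s)%N -> ~~ (k %| j.+1)%N ->
      (nth 0 s j.+1 < nth 0 s j)%N.
Proof.
move=> k_gt0; split=> -[s_pos H]; split=> //.
  (* The block containing the 1-based index [j.+1] has number [(j.+1 %/ k).+1], as [k] does not
     divide [j.+1]. *)
  move=> j lt_js ndvd; have := H (j.+1 %/ k).+1 j.+1 isT _ _ lt_js.
  have := divn_eq j.+1 k; have := ltn_pmod j.+1 k_gt0.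
  by move: ndvd; rewrite /dvdn /part /=; move: (_ %% _)%N (_ %/ _)%N => r q; nia.
move=> i [|j] i_gt0 le_ij lt_ji lt_js; first by move: le_ij; nia.
(* A multiple of [k] cannot lie strictly between [k * (i - 1)] and [k * i]. *)
apply: H => //; apply/negP => /dvdnP[q q_eq]; move: le_ij lt_ji; rewrite q_eq.
rewrite (mulnC q) ltn_pmul2l // => + lt_qi; case: i lt_qi {i_gt0} => // i.
by rewrite ltnS mulnS; nia.
Qed.

Lemma pairwise_gtnP (s : seq nat) :
  reflect (forall j, (j.+1 < size s)%N -> (nth 0 s j.+1 < nth 0 s j)%N)
          (pairwise gtn s).
Proof.
rewrite -sorted_pairwise; last by move=> a b c /= ba cb; apply: ltn_trans ba.
exact: sortedP.
Qed.

Lemma block_arndt_short k s : (size s < k)%N ->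
  block_arndt k s <-> decreasing (size s) s.
Proof.
move=> lt_sk; rewrite block_arndtE; last by apply: leq_ltn_trans lt_sk.
split=> [[s_pos H]|[s_pos _ /pairwise_gtnP H]]; split=> //; last by move=> j /H.
apply/pairwise_gtnP => j lt_js; apply: H => //.
by rewrite gtnNdvd // (ltn_trans lt_js).
Qed.

(** The seam sits at index [k], where nothing is compared, and shifting indices by [k] preserves
    divisibility by [k]. *)
Lemma block_arndt_cat k u v : (0 < k)%N -> size u = k ->
  block_arndt k (u ++ v) <-> decreasing k u /\ block_arndt k v.
Proof.
move=> k_gt0 sz_u; rewrite !block_arndtE // /is_composition all_cat size_cat sz_u.
split=> [[/andP[u_pos v_pos] H]|[[u_pos _ /pairwise_gtnP Hu] [v_pos Hv]]].
  split; split=> //.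
    apply/pairwise_gtnP => j; rewrite sz_u => lt_jk; have := H j.
    rewrite !nth_cat sz_u lt_jk (ltnW lt_jk); apply; last by rewrite gtnNdvd.
    exact: ltn_addr.
  have ltF i : (k + i < k)%N = false by rewrite ltnNge leq_addr.
  move=> j lt_jv ndvd; have := H (k + j)%N.
  rewrite !nth_cat sz_u ltF addKn -addnS ltF addKn; apply; first by rewrite ltn_add2l.
  by rewrite dvdn_addr.
split=> [|j lt_j ndvd]; first exact/andP.
(* The compared entries lie both in [u], both in [v], or across the seam, which [ndvd] excludes. *)
rewrite !nth_cat sz_u; have [lt_jk|le_kj|eq_jk] := ltngtP j.+1 k.
- by rewrite Hu // sz_u.
- rewrite subSn //; apply: Hv; first by lia.
  by rewrite -subSn // (dvdn_subl (ltnW le_kj)).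
- by rewrite eq_jk dvdnn in ndvd.
Qed.

(** A sequence of exactly [k] parts falls under the second set, with an empty remainder. *)
Lemma block_arndt_split k : (0 < k)%N ->
  block_arndt k = [set s | decreasing (size s) s /\ (size s < k)%N] `|`
    (fun p => p.1 ++ p.2) @` (decreasing k `*` block_arndt k).
Proof.
move=> k_gt0; apply/seteqP; split=> [s As|s].
  have [lt_sk|le_ks] := ltnP (size s) k.
    by left; split=> //; apply/(block_arndt_short lt_sk).
  right; exists (take k s, drop k s); rewrite /= ?cat_take_drop //.
  by apply/(block_arndt_cat _ k_gt0); rewrite ?size_takel ?cat_take_drop.
move=> [[s_dec lt_sk]|[[u v] [/= Du Av] <-]]; first exact/block_arndt_short.
by apply/block_arndt_cat => //; case: Du.
Qed.

Theorem theorem5p1 (k : nat) (hk : (0 < k)%N) :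
  fps2_has_sum (block_arndt k)
    (fun s : seq nat => xvar ^+ (sumn s) * yvar ^+ (size s))
    ((1 - J k)^-1 * \sum_(0 <= j < k) J j).
Proof.
have [S HS] := fps2_has_sum_weight (block_arndt k).
(* This equation determines [S], because [1 - J k] is a unit. *)
suff S_eq : S = \sum_(0 <= j < k) J j + J k * S.
  suff <- : S = (1 - J k)^-1 * \sum_(0 <= j < k) J j by [].
  apply: (mulrI (unit_1BJ hk)); rewrite mulVKr ?unit_1BJ // mulrBl mul1r.
  by rewrite {1}S_eq addrK.
apply: (fps2_has_sum_unique HS); rewrite {1}(block_arndt_split hk).
apply: fps2_has_sumU; last 2 first.
- exact: fps2_has_sum_decreasing_lt.
- apply: fps2_has_sum_image.
    (* Concatenation is injective here because both first blocks have length [k]. *)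
    move=> [u v] [u' v']; rewrite !inE => -[/= [_ sz_u _] _] [/= [_ sz_u' _] _].
    by move=> /eqP; rewrite eqseq_cat ?sz_u ?sz_u' // => /andP[/eqP -> /eqP ->].
  apply: eq_fps2_has_sum (fps2_has_sumM (fps2_has_sum_decreasing k) HS).
  by move=> [u v] _; rewrite -weight_cat.
(* The two sets are disjoint: a sequence with a full first block has at least [k] parts. *)
move=> s [[_ lt_sk] [[u v] [/= [_ sz_u _] _] s_eq]]; move: lt_sk.
by rewrite -s_eq size_cat sz_u ltnNge leq_addr.
Qed.
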